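(* Let $t,q$ be positive integers, let $k=tq$, and suppose that $[k+k^2]_{tn}=0$. Suppose that $(Q_i,*_i)$, $i=1,2,\ldots,t$, are pairwise disjoint left unitary $k$-translatable semigroups of cardinality $n$, where $Q_i$ has ordering $i_1,i_2,\ldots,i_n$. Let $Q=\bigcup_{i=1}^t Q_i$ be ordered so that the element $i_r$ is the $(t(r-1)+i)$-th element ($i=1,\ldots,t$, $r=1,\ldots,n$), i.e. identify $i_r=t(r-1)+i\in\{1,\ldots,tn\}$. Then $Q$ is a left unitary $k$-translatable semigroup with respect to this ordering and the product $*$ defined by $$i_r*j_s=j_x,\quad\text{where } x=[k-kr+q-qi+s]_n,$$ in which each $(Q_i,* )$ is isomorphic to $(Q_i,*_i)$. Furthermore, if a product $*$ on $Q=\bigcup_{i=1}^t Q_i$ is defined by the formula above, then there is an ordering on $Q$ such that $(Q,* )$ is a left unitary $k$-translatable semigroup in which each $(Q_i,* )$ is isomorphic to $(Q_i,*_i)$.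
   Context: A groupoid is a set with a binary operation; a semigroup is an associative groupoid. For integers $x$ and $N\ge1$, $[x]_N$ denotes the residue of $x$ modulo $N$, represented in $\{1,\ldots,N\}$, with $0$ identified with $N$; $[x]_N=0$ means $N\mid x$. For $1\le k<N$, a groupoid $(G,\circ)$ of order $N$ is $k$-translatable with respect to an ordering $g_1,\ldots,g_N$ of its elements if in its multiplication table each row is obtained from the preceding one by cyclically shifting it $k$ places to the right, i.e. $g_u\circ g_v=g_{u-1}\circ g_{[v-k]_N}$ for all $v$ and all $2\le u\le N$. It is left unitary (with respect to this ordering) if $g_1$ is a left neutral element, i.e. $g_1\circ x=x$ for all $x$. ''Left unitary $k$-translatable semigroup'' means both properties hold with respect to the same ordering. *)

(* Defs.v *)
From mathcomp Require Import all_boot all_order all_algebra.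
From mathcomp Require Import boolp classical_sets functions.

Set Implicit Arguments.
Unset Strict Implicit.
Unset Printing Implicit Defensive.

Import GRing.Theory.

Local Open Scope classical_set_scope.
Local Open Scope nat_scope.

(* All indices are natural numbers counted from 1, as in g_1, ..., g_N. *)
Definition index_set (N : nat) : set nat := [set r | 1 <= r <= N].

(* [x]_N, the representative of x modulo N in {1, ..., N} (for N >= 1). *)
Definition res (N : nat) (x : int) : nat :=
  let r := `|(x %% N%:Z)%Z| in if r == 0 then N else r.

Section Groupoids.
Variable T : Type.

(* A groupoid is carried by a set A of elements of an ambient type T; its
   operation is a function on T of which only the values on A matter. *)
Definition groupoid (A : set T) (op : T -> T -> T) : Prop :=
  forall x y, A x -> A y -> A (op x y).

Definition semigroup (A : set T) (op : T -> T -> T) : Prop :=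
  groupoid A op /\
  forall x y z, A x -> A y -> A z -> op x (op y z) = op (op x y) z.

(* g 1, ..., g N lists every element of A exactly once; in particular A has
   cardinality N.  The values of g outside {1, ..., N} are irrelevant. *)
Definition ordering (A : set T) (N : nat) (g : nat -> T) : Prop :=
  set_bij (index_set N) A g.

Definition translatable (k : nat) (A : set T) (op : T -> T -> T)
    (N : nat) (g : nat -> T) : Prop :=
  [/\ 1 <= k < N, groupoid A op, ordering A N g &
      forall u v, 2 <= u <= N -> 1 <= v <= N ->
        op (g u) (g v) = op (g u.-1) (g (res N (v%:Z - k%:Z)%R))].

Definition left_unitary (A : set T) (op : T -> T -> T) (g : nat -> T) : Prop :=
  forall x, A x -> op (g 1) x = x.

Definition left_unitary_translatable_semigroup (k : nat) (A : set T)
    (op : T -> T -> T) (N : nat) (g : nat -> T) : Prop :=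
  [/\ semigroup A op, translatable k A op N g & left_unitary A op g].

Definition isomorphic (A : set T) (opA : T -> T -> T)
    (B : set T) (opB : T -> T -> T) : Prop :=
  [/\ groupoid A opA, groupoid B opB &
      exists f : T -> T, set_bij A B f /\
        forall x y, A x -> A y -> f (opA x y) = opB (f x) (f y)].

(* With g i r standing for i_r, the sequence whose (t(r-1)+i)-th term is i_r;
   see interleaveE. *)
Definition interleave (t : nat) (g : nat -> nat -> T) (m : nat) : T :=
  g (m.-1 %% t).+1 (m.-1 %/ t).+1.

Lemma interleaveE (t : nat) (g : nat -> nat -> T) (i r : nat) :
  1 <= i <= t -> 1 <= r -> interleave t g (t * (r - 1) + i) = g i r.
Proof.
case: i => // i /= it; case: r => // r _; rewrite /interleave subn1 /=.
by rewrite addnS /= mulnC modnMDl modn_small // divnMDl ?(leq_trans _ it) //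
  divn_small // addn0.
Qed.

(* i_r * j_s = j_x with x = [k - kr + q - qi + s]_n. *)
Definition product_formula (t q n k : nat) (g : nat -> nat -> T)
    (op : T -> T -> T) : Prop :=
  forall i j r s, 1 <= i <= t -> 1 <= j <= t -> 1 <= r <= n -> 1 <= s <= n ->
    op (g i r) (g j s) =
    g j (res n (k%:Z - k%:Z * r%:Z + q%:Z - q%:Z * i%:Z + s%:Z)%R).

End Groupoids.

(* Main.v *)
Require Import Defs.
From mathcomp Require Import all_boot all_order all_algebra.
From mathcomp Require Import boolp classical_sets functions.
From mathcomp Require Import zify ring.

(** Fix an ordering [g_1, ..., g_N] of a set [A] and read indices modulo [N].
    A product on [A] is left unitary and [k]-translatable exactly when row [u]
    is the identity row shifted by [k (u - 1)], that is
    [g_u g_v = g_(v + k - k u)].  Left multiplication by [g_u] is then the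
    translation of indices by [a = k (1 - u)], and comparing [x (y z)] with
    [(x y) z] shows that the product is associative as soon as [a (1 + k) = 0]
    modulo [N] for all these [a], which follows from [N | k + k^2].
    [cyclic_product_luts] and [luts_cyclic_product] are these two directions.

    The product on the union is of this form.  Let [m = t (r - 1) + i] be the
    position of [i_r] and [p = t (s - 1) + j] that of [j_s].  As [k = t q], the
    amount [k - k r + q - q i] added to [s] is [q (1 - m)], so the position [p]
    moves by [t q (1 - m) = k (1 - m)] modulo [t n].  Hence the product formula
    says precisely that [h_m * h_p = h_(p + k - k m)] for the interleaved
    ordering [h] ([interleave_cyclic_product]), and the hypothesis
    [t n | k + k^2] makes it a left unitary [k]-translatable semigroup.

    Restricted to [Q_i], the formula is the original product of [Q_i] with all
    results translated by [q - q i].  Translating indices by [c] conjugates one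
    product into the other if [- k c = q - q i] modulo [n]
    ([cyclic_shift_isomorphic]).  Cancelling [t] in [t n | t q (1 + k)] gives
    [k q = - q] modulo [n], so [c = q - q i] is such a translation. *)

Set Implicit Arguments.
Unset Strict Implicit.
Unset Printing Implicit Defensive.

Import GRing.Theory Num.Theory.

Local Open Scope classical_set_scope.
Local Open Scope nat_scope.

(** * Residues in 1..N *)

Lemma res_bounds (N : nat) (x : int) : 0 < N -> 1 <= res N x <= N.
Proof.
move=> N0; rewrite /res.
have x0 : (0 <= x %% N%:Z)%Z%R by rewrite modz_ge0; lia.
have xN : (x %% N%:Z < N%:Z)%Z%R by rewrite ltz_pmod; lia.
case: eqP => ?; lia.
Qed.

Lemma dvdz_res_sub (N : nat) (x : int) :
  0 < N -> (N%:Z %| (res N x)%:Z - x)%Z%R.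
Proof.
move=> N0; rewrite /res.
have x0 : (0 <= x %% N%:Z)%Z%R by rewrite modz_ge0; lia.
have xE := divz_eq x N%:Z.
apply/dvdzP; case: eqP => x1.
  by exists (1 - (x %/ N%:Z)%Z)%R; lia.
by exists (- (x %/ N%:Z)%Z)%R; lia.
Qed.

Lemma eq_res (N : nat) (x y : int) :
  (N%:Z %| x - y)%Z%R -> res N x = res N y.
Proof. by rewrite -eqz_mod_dvd => /eqP xy; rewrite /res xy. Qed.

Lemma res_inj (N : nat) (x y : int) :
  0 < N -> res N x = res N y -> (N%:Z %| x - y)%Z%R.
Proof.
move=> N0 xy; have := dvdz_res_sub y N0; have := dvdz_res_sub x N0.
rewrite xy -!eqz_mod_dvd => /eqP <- /eqP ->.
exact: eqxx.
Qed.

Lemma res_small (N r : nat) : 1 <= r <= N -> res N r%:Z = r.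
Proof.
move=> /andP[r1]; rewrite leq_eqVlt /res modz_nat absz_nat => /predU1P[->|rN].
  by rewrite modnn.
by rewrite modn_small //; case: eqP; lia.
Qed.

(** The form used to compute residues: a number in range and in the right
    class is the residue. *)
Lemma res_unique (N r : nat) (x : int) :
  1 <= r <= N -> (N%:Z %| x - r%:Z)%Z%R -> res N x = r.
Proof. by move=> rN /eq_res ->; exact: res_small. Qed.

(** * Products that translate indices cyclically *)

Section Cyclic.
Variable T : Type.
Implicit Types (A : set T) (op : T -> T -> T) (g : nat -> T).

Definition cyclic_product (k N : nat) g op : Prop :=
  forall u v, 1 <= u <= N -> 1 <= v <= N ->
    op (g u) (g v) = g (res N (v%:Z + k%:Z - k%:Z * u%:Z)%R).

Lemma ordering_res A N g : 0 < N -> ordering A N g ->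
  forall x, A (g (res N x)).
Proof. by move=> N0 [gA _ _] x; apply: gA; exact: res_bounds. Qed.

Lemma ordering_resP A N g a : ordering A N g -> A a ->
  exists x, a = g (res N x).
Proof.
move=> [_ _ gs] /gs[r rN <-]; exists (Posz r).
by rewrite res_small.
Qed.

(** The position of an element; 0 is a default value, outside the index set. *)
Definition rank (N : nat) g (a : T) : nat :=
  xget 0 [set r | index_set N r /\ g r = a].

Lemma rankE A N g r : ordering A N g -> 1 <= r <= N -> rank N g (g r) = r.
Proof.
move=> [_ gi _] rN; rewrite /rank.
case: xgetP => [s _ [sN sr]|/(_ r) []//].
by apply: gi => //; rewrite inE.
Qed.

(** Changing [x] or [y] by a multiple of [N] does not change [y + k - k x]
    modulo [N]; so indices can be handled as integers, without reducing
    intermediate results to the range 1..N. *)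
Lemma cyclic_productE k N g op : 0 < N -> cyclic_product k N g op ->
  forall x y, op (g (res N x)) (g (res N y)) =
              g (res N (y + k%:Z - k%:Z * x)%R).
Proof.
move=> N0 opE x y; rewrite opE ?res_bounds//; congr (g _); apply: eq_res.
have /dvdzP[a xE] := dvdz_res_sub x N0; have /dvdzP[b yE] := dvdz_res_sub y N0.
apply/dvdzP; exists (b - k%:Z * a)%R.
have -> : Posz (res N x) = (x + a * N%:Z)%R by lia.
have -> : Posz (res N y) = (y + b * N%:Z)%R by lia.
ring.
Qed.

(** Iterating translatability up to the first row, which is the identity row. *)
Lemma luts_cyclic_product k A op N g :
  left_unitary_translatable_semigroup k A op N g -> cyclic_product k N g op.
Proof.
move=> [_ [/andP[k1 kN] _ oA tr] lu].
have N0 : 0 < N by lia.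
elim=> // u IHu v uN vN; case: (posnP u) => [u0|u1].
  rewrite u0 lu; last by case: oA => gA _ _; exact: gA.
  by rewrite mulr1 addrK res_small.
rewrite tr /=; [|lia|lia].
rewrite IHu ?res_bounds//; last lia.
congr (g _); apply: eq_res.
have /dvdzP[a vE] := dvdz_res_sub (v%:Z - k%:Z)%R N0.
apply/dvdzP; exists a; lia.
Qed.

Lemma cyclic_product_luts k A op N g :
  1 <= k < N -> N %| k + k ^ 2 -> ordering A N g -> cyclic_product k N g op ->
  left_unitary_translatable_semigroup k A op N g.
Proof.
move=> kN dvdk oA opc; have N0 : 0 < N by lia.
have opE := cyclic_productE N0 opc.
have Aop : groupoid A op.
  move=> a b /(ordering_resP oA)[x ->] /(ordering_resP oA)[y ->].
  by rewrite opE; exact: (ordering_res N0 oA).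
split; [split=> //|split=> //|].
- move=> a b c /(ordering_resP oA)[x ->] /(ordering_resP oA)[y ->].
  move=> /(ordering_resP oA)[z ->]; rewrite !opE; congr (g _); apply: eq_res.
  (* the two indices differ by (k + k^2) (1 - x) *)
  have /dvdnP[e /(congr1 Posz)] := dvdk; rewrite PoszD !PoszM => ke.
  apply/dvdzP; exists (e%:Z * (1 - x))%R.
  have -> : (e%:Z * (1 - x) * N%:Z = (e%:Z * N%:Z) * (1 - x))%R by ring.
  rewrite -ke; ring.
- move=> u v uN vN; have u0 : 1 <= u <= N by lia.
  have u1 : 1 <= u.-1 <= N by lia.
  rewrite -{1}(res_small u0) -{1}(res_small vN) -(res_small u1) !opE.
  congr (g (res N _)).
  have -> : (u.-1%:Z = u%:Z - 1)%R by lia.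
  ring.
- move=> a /(ordering_resP oA)[x ->].
  have N1 : 1 <= 1 <= N by lia.
  by rewrite -(res_small N1) opE mulr1 addrK.
Qed.

(** The translation of indices by [c] is an isomorphism: applied to a product
    it gives the index [s + k - k r - k c + c], which is what the second
    product makes of the indices [r + c] and [s + c]. *)
Lemma cyclic_shift_isomorphic k A op op' N g (c : int) :
  0 < N -> ordering A N g -> cyclic_product k N g op' ->
  (forall r s, 1 <= r <= N -> 1 <= s <= N ->
    op (g r) (g s) = g (res N (s%:Z + k%:Z - k%:Z * r%:Z - k%:Z * c)%R)) ->
  isomorphic A op A op'.
Proof.
move=> N0 oA opc' opE; have opE' := cyclic_productE N0 opc'.
have Ag := ordering_res N0 oA.
split.
- move=> a b; have [_ _ gs] := oA.
  by move=> /gs[r rN <-] /gs[s sN <-]; rewrite opE.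
- move=> a b /(ordering_resP oA)[x ->] /(ordering_resP oA)[y ->].
  by rewrite opE'.
pose f a := g (res N ((rank N g a)%:Z + c)%R).
have fE x : f (g (res N x)) = g (res N (x + c)%R).
  rewrite /f (rankE oA) ?res_bounds//; congr (g _); apply: eq_res.
  have /dvdzP[a xE] := dvdz_res_sub x N0.
  apply/dvdzP; exists a; lia.
exists f; split.
  split=> [a /(ordering_resP oA)[x ->]|a b|a /(ordering_resP oA)[x ->]].
  - by rewrite fE.
  - rewrite !inE => /(ordering_resP oA)[x ->] /(ordering_resP oA)[y ->].
    rewrite !fE; have [_ gi _] := oA => /gi; rewrite !inE => xy.
    have /(res_inj N0) := xy (res_bounds _ N0) (res_bounds _ N0).
    rewrite opprD addrACA subrr addr0 => xyN.
    by congr (g _); exact: eq_res.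
  - by exists (g (res N (x - c)%R)) => //; rewrite fE subrK.
have [_ _ gs] := oA; move=> _ _ /gs[r rN <-] /gs[s sN <-].
rewrite opE// fE -{2}(res_small rN) -{2}(res_small sN) !fE opE'.
by congr (g (res N _)); ring.
Qed.

(** * The interleaved ordering of a disjoint union *)

Lemma position_bounds (t n i r : nat) :
  1 <= i <= t -> 1 <= r <= n -> 1 <= t * (r - 1) + i <= t * n.
Proof. by nia. Qed.

Lemma position_coords (t n m : nat) : 1 <= m <= t * n ->
  exists i r, [/\ 1 <= i <= t, 1 <= r <= n & m = t * (r - 1) + i].
Proof.
move=> mN; have t0 : 0 < t by case: (t) mN; lia.
exists (m.-1 %% t).+1, (m.-1 %/ t).+1; split.
- by rewrite /= ltn_mod.
- by rewrite /= ltn_divLR // (mulnC n); lia.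
- have := divn_eq m.-1 t; rewrite (mulnC t) subn1 /=; lia.
Qed.

Lemma Posz_position (t i r : nat) : 1 <= r ->
  Posz (t * (r - 1) + i) = (t%:Z * (r%:Z - 1) + i%:Z)%R.
Proof. by move=> r1; rewrite PoszD PoszM -subzn. Qed.

(** Moving the index by [n] inside one component moves the interleaved position
    by [t n], so the two residues wrap around together. *)
Lemma interleave_res (t n : nat) (g : nat -> nat -> T) (i : nat) (x : int) :
  0 < n -> 1 <= i <= t ->
  interleave t g (res (t * n) (t%:Z * (x - 1) + i%:Z)%R) = g i (res n x).
Proof.
move=> n0 it; have xn := res_bounds x n0.
rewrite -[RHS](@interleaveE T t g)//; last by case/andP: xn.
congr (interleave _ _ _); apply: res_unique; first exact: position_bounds.
have /dvdzP[a xE] := dvdz_res_sub x n0.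
apply/dvdzP; exists (- a)%R.
rewrite Posz_position; last by case/andP: xn.
have -> : Posz (res n x) = (x + a * n%:Z)%R by lia.
rewrite PoszM; ring.
Qed.

Lemma interleave_ordering (t n : nat) (Qi : nat -> set T)
    (g : nat -> nat -> T) :
  trivIset (index_set t) Qi ->
  (forall i, 1 <= i <= t -> ordering (Qi i) n (g i)) ->
  ordering (\bigcup_(i in index_set t) Qi i) (t * n) (interleave t g).
Proof.
move=> tQ oQ; split.
- move=> _ /position_coords[i [r [it rn ->]]].
  rewrite interleaveE//; last by case/andP: rn.
  by exists i => //; have [gQ _ _] := oQ i it; exact: gQ.
- move=> m p; rewrite !inE => /position_coords[i [r [it rn ->]]].
  move=> /position_coords[j [s [jt sn ->]]].
  have [[r1 _] [s1 _]] := (andP rn, andP sn).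
  rewrite !interleaveE// => gg.
  have [[gQi gI _] [gQj _ _]] := (oQ i it, oQ j jt).
  have ij : i = j.
    apply: tQ => //; exists (g i r); split; first exact: gQi.
    by rewrite gg; exact: gQj.
  subst j; congr (_ * (_ - 1) + _).
  by apply: gI => //; rewrite inE.
- move=> a [i it] Qa; have [_ _ gs] := oQ i it.
  have [r rn <-] := gs a Qa.
  exists (t * (r - 1) + i); first exact: position_bounds.
  by rewrite interleaveE//; case/andP: rn.
Qed.

(** Adding [k (1 - r) + q (1 - i)] to [s] adds [t] times as much to the
    position of [j_s]; with [k = t q] that is [k] times one minus the position
    of [i_r].  In particular the component [j] is preserved because the shift
    [k] is a multiple of [t]. *)
Lemma interleave_cyclic_product (t q n : nat) (g : nat -> nat -> T) op :
  0 < n -> product_formula t q n (t * q) g op <->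
  cyclic_product (t * q) (t * n) (interleave t g) op.
Proof.
move=> n0.
(* both formulas attach the same product to the pair of positions *)
have key i j r s : 1 <= i <= t -> 1 <= j <= t -> 1 <= r <= n -> 1 <= s <= n ->
    g j (res n ((t * q)%:Z - (t * q)%:Z * r%:Z + q%:Z - q%:Z * i%:Z + s%:Z)%R) =
    interleave t g (res (t * n) ((t * (s - 1) + j)%:Z + (t * q)%:Z
                      - (t * q)%:Z * (t * (r - 1) + i)%:Z)%R).
  move=> it jt rn sn; rewrite -(interleave_res g _ n0 jt).
  rewrite !Posz_position//; [|by case/andP: rn|by case/andP: sn].
  by congr (interleave _ _ (res _ _)); rewrite PoszM; ring.
split=> opE.
- move=> u v /position_coords[i [r [it rn ->]]].
  move=> /position_coords[j [s [jt sn ->]]].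
  have [[r1 _] [s1 _]] := (andP rn, andP sn).
  by rewrite -key// -opE// !interleaveE.
- move=> i j r s it jt rn sn; have [[r1 _] [s1 _]] := (andP rn, andP sn).
  by rewrite key// -opE ?position_bounds// !interleaveE.
Qed.

Lemma cyclic_product_exists (k N : nat) A g : ordering A N g ->
  exists op, cyclic_product k N g op.
Proof.
move=> oA; exists (fun a b =>
  g (res N ((rank N g b)%:Z + k%:Z - k%:Z * (rank N g a)%:Z)%R)).
by move=> u v uN vN; rewrite !(rankE oA).
Qed.

End Cyclic.

Theorem theorem6p2 (T : Type) (t q n k : nat)
    (Qi : nat -> set T) (opi : nat -> T -> T -> T) (g : nat -> nat -> T)
    (Q := \bigcup_(i in index_set t) Qi i) :
  0 < t -> 0 < q -> k = t * q -> t * n %| k + k ^ 2 ->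
  trivIset (index_set t) Qi ->
  (forall i, 1 <= i <= t ->
     left_unitary_translatable_semigroup k (Qi i) (opi i) n (g i)) ->
  [/\ exists op : T -> T -> T, product_formula t q n k g op,
      forall op : T -> T -> T, product_formula t q n k g op ->
        left_unitary_translatable_semigroup k Q op (t * n) (interleave t g) /\
        (forall i, 1 <= i <= t -> isomorphic (Qi i) op (Qi i) (opi i)) &
      forall op : T -> T -> T, product_formula t q n k g op ->
        exists h : nat -> T,
          left_unitary_translatable_semigroup k Q op (t * n) h /\
          (forall i, 1 <= i <= t -> isomorphic (Qi i) op (Qi i) (opi i))].
Proof.
move=> t0 _ kE dvdk tQ lutsQ; subst k.
have kn : 1 <= t * q < n by have [_ [? _ _ _] _] := lutsQ 1 t0.
have n0 : 0 < n by lia.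
have oQi i : 1 <= i <= t -> ordering (Qi i) n (g i).
  by move=> /lutsQ[_ [_ _ ? _] _].
have oQ : ordering Q (t * n) (interleave t g) by exact: interleave_ordering.
have main op : product_formula t q n (t * q) g op ->
    left_unitary_translatable_semigroup (t * q) Q op (t * n) (interleave t g) /\
    (forall i, 1 <= i <= t -> isomorphic (Qi i) op (Qi i) (opi i)).
  move=> opE; split.
    apply: cyclic_product_luts => //; first by nia.
    exact/(interleave_cyclic_product t q g op n0).
  move=> i it.
  have /dvdnP[e /(congr1 Posz) ke] : n %| q + t * q * q.
    have kE : t * q + (t * q) ^ 2 = t * (q + t * q * q) by rewrite -mulnn; lia.
    by rewrite -(dvdn_pmul2l t0) -kE.
  apply: (@cyclic_shift_isomorphic T (t * q) _ _ _ n (g i)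
            (q%:Z - q%:Z * i%:Z)%R n0 (oQi i it)).
    exact: luts_cyclic_product (lutsQ i it).
  move=> r s rn sn; rewrite opE//; congr (g i _); apply: eq_res.
  (* the two indices differ by (q + k q) (1 - i) *)
  apply/dvdzP; exists (e%:Z * (1 - i%:Z))%R.
  have -> : (e%:Z * (1 - i%:Z) * n%:Z = (e * n)%:Z * (1 - i%:Z))%R.
    by rewrite PoszM; ring.
  by rewrite -ke PoszD !PoszM; ring.
split=> // [|op /main]; last by exists (interleave t g).
have [op opc] := cyclic_product_exists (t * q) oQ.
by exists op; exact/(interleave_cyclic_product t q g op n0).
Qed.
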